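(* Let $p\geq 2$ and let $V_1,\dots,V_p$ be pairwise disjoint finite sets. For each $i=1,\dots,p$ let $\mathcal{H}_i\subseteq 2^{V_i}$ be a hypergraph on $V_i$ which either is JM+ or is of the form $\mathcal{H}_i=\{\{a_i\},\{b_i\}\}$ with $V_i=\{a_i,b_i\}$, $a_i\neq b_i$ (a copy of $\binom{[2]}{1}$). Then the conjunctive compound $\mathcal{H}_1\otimes\dots\otimes\mathcal{H}_p$ is a JM+ hypergraph on $V_1\cup\dots\cup V_p$.
   Context: A hypergraph on a finite set $V$ is a family $\mathcal{H}\subseteq 2^V$ of nonempty subsets (edges) with $\bigcup_{H\in\mathcal{H}}H=V$. Positions are vectors $\mathbf{x}\in\mathbb{Z}_{+}^V$ ($\mathbb{Z}_+$ = nonnegative integers). In the game Nim$_\mathcal{H}$, a move $\mathbf{x}\to\mathbf{x}'$ (an $H$-move) consists of choosing an edge $H\in\mathcal{H}$ and passing to a position $\mathbf{x}'$ with $x'_i<x_i$ for $i\in H$ and $x'_i=x_i$ for $i\notin H$. The height $h_\mathcal{H}(\mathbf{x})$ is the maximum number of consecutive moves that can be made starting from $\mathbf{x}$. Let $m(\mathbf{x})=\min_{i\in V}x_i$. Properties: (A) An edge $H\in\mathcal{H}$ is transversal if $H\cap H'\neq\emptyset$ for all $H'\in\mathcal{H}$; $\mathcal{H}$ is transversal-free if it has no transversal edge. For $S\subseteq V$, $\mathcal{H}_S=\{H\in\mathcal{H}\mid H\subseteq S\}$. $\mathcal{H}$ satisfies (A) (is minimal transversal-free) if it is transversal-free but for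 every proper subset $S\subsetneq V$ with $\mathcal{H}_S\neq\emptyset$, $\mathcal{H}_S$ has a transversal edge (an edge of $\mathcal{H}_S$ meeting all edges of $\mathcal{H}_S$). (B) $\mathcal{H}$ is minimum-decreasing if for every position $\mathbf{x}$ with $m(\mathbf{x})>0$ there is a move $\mathbf{x}\to\mathbf{x}'$ with $m(\mathbf{x}')<m(\mathbf{x})$, $h_\mathcal{H}(\mathbf{x}')=h_\mathcal{H}(\mathbf{x})-1$ and $x_i-x'_i\leq 1$ for all $i\in V$. (C) A sequence of edges $H_0,\dots,H_q$ is a chain if for all $i=0,\dots,q-1$: $H_{i+1}\cap H_i\neq\emptyset$, $|H_{i+1}\setminus H_i|=1$, and $H_i\subseteq H_0\cup H_q$; $\mathcal{H}$ has the chain property if for any two distinct edges $H,H'$ there is a chain with $H_0=H$, $H_q=H'$. $\mathcal{H}$ is JM+ if it satisfies (A), (B) and (C). For hypergraphs $\mathcal{H}_i\subseteq 2^{V_i}$ on pairwise disjoint sets, the conjunctive compound is $\mathcal{H}_1\otimes\dots\otimes\mathcal{H}_p=\{\bigcup_{i=1}^p H^i\mid H^i\in\mathcal{H}_i,\ i=1,\dots,p\}$. *)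

(* Defs.v *)
From mathcomp Require Import all_boot.

Set Implicit Arguments.
Unset Strict Implicit.
Unset Printing Implicit Defensive.

(* All vertex sets live in an ambient finite type T; a family of edges is a
   {set {set T}}, and its vertex set V : {set T} is passed explicitly. *)

Section Hypergraph.

Variable T : finType.

Implicit Types (V S E F : {set T}) (H : {set {set T}}) (x y : {ffun T -> nat}).

(* V != set0 is implicit in the literature: min_(i in V) x_i must exist. *)
Definition is_hypergraph V H : Prop :=
  [/\ V != set0, set0 \notin H & cover H = V].

(* Z_+^V, encoded as the functions on T that vanish outside V. *)
Definition is_position V x : Prop := forall i, i \notin V -> x i = 0.

Definition move H x y : bool :=
  [exists E in H, forall i, if i \in E then y i < x i else y i == x i].

(* n is the maximum number of consecutive moves from x; see height_exists and
   height_unique below. *)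
Definition is_height H x (n : nat) : Prop :=
  (exists2 s : seq {ffun T -> nat}, path (move H) x s & size s = n) /\
  (forall s : seq {ffun T -> nat}, path (move H) x s -> size s <= n).

(* The default value is at least every x i with i in V, so for V != set0 this
   is the genuine minimum; see min_pos_le and min_pos_attained below. *)
Definition min_pos V x : nat := \big[minn/(\max_(i in V) x i)]_(i in V) x i.

Definition transversal_edge H E : Prop :=
  E \in H /\ (forall F, F \in H -> E :&: F != set0).

Definition transversal_free H : Prop := ~ exists E, transversal_edge H E.

Definition induced H S : {set {set T}} := [set E in H | E \subset S].

Definition minimal_transversal_free V H : Prop :=
  transversal_free H /\
  (forall S, S \proper V -> induced H S != set0 ->
     exists E, transversal_edge (induced H S) E).

(* The height condition h(x') = h(x) - 1 reads h(x) = n.+1 and h(x') = n. *)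
Definition minimum_decreasing V H : Prop :=
  forall x, is_position V x -> 0 < min_pos V x ->
  exists x', [/\ move H x x',
    min_pos V x' < min_pos V x,
    exists2 n, is_height H x n.+1 & is_height H x' n
    & forall i, i \in V -> x i - x' i <= 1].

Definition chain_step E F : bool := (F :&: E != set0) && (#|F :\: E| == 1).

(* The sequence H_0, H_1, ..., H_q is E0 :: s; its last term is last E0 s. *)
Definition chain H E0 (s : seq {set T}) : bool :=
  [&& all (mem H) (E0 :: s), path chain_step E0 s
    & all (fun E => E \subset E0 :|: last E0 s) (E0 :: s)].

Definition chain_property H : Prop :=
  forall E F, E \in H -> F \in H -> E != F ->
  exists2 s, chain H E s & last E s = F.

Definition JM_plus V H : Prop :=
  [/\ minimal_transversal_free V H, minimum_decreasing V H & chain_property H].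

(* A copy of the hypergraph of all 1-subsets of a 2-set. *)
Definition two_singletons V H : Prop :=
  exists a b : T, [/\ a != b, V = [set a; b] & H = [set [set a]; [set b]]].

Definition conj_compound (p : nat) (H : 'I_p -> {set {set T}}) : {set {set T}} :=
  [set \bigcup_i f i | f : {ffun 'I_p -> {set T}} in family H].

Lemma move_sum H x y : set0 \notin H -> move H x y ->
  \sum_i y i < \sum_i x i.
Proof.
move=> H0 /existsP[E /andP[EH /forallP xy]].
have [i iE] : exists i, i \in E.
  by apply/set0Pn; apply: contraNneq H0 => <-.
have le_yx j : y j <= x j by have := xy j; case: ifP => _ => [/ltnW|/eqP->].
rewrite (bigD1 i) //= (bigD1 i (F := x)) //= -addSn leq_add ?leq_sum //.
by have := xy i; rewrite iE.
Qed.

Lemma play_bound H x s : set0 \notin H -> path (move H) x s ->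
  size s <= \sum_i x i.
Proof.
move=> H0; elim: s x => //= y s IHs x /andP[/(move_sum H0) lt_yx /IHs le_s].
exact: leq_ltn_trans le_s lt_yx.
Qed.

Lemma height_exists H x : set0 \notin H -> exists n, is_height H x n.
Proof.
move=> H0; have [N] := ubnP (\sum_i x i); elim: N x => // N IHN x lt_xN.
pose g (z : {ffun T -> 'I_N.+1}) : {ffun T -> nat} := [ffun i => nat_of_ord (z i)].
have /fin_all_exists[h hP] z :
    exists n, move H x (g z) -> is_height H (g z) n.
  case: (boolP (move H x (g z))) => [xz | _]; last by exists 0.
  have [|n hn] := IHN (g z); last by exists n.
  exact: leq_trans (move_sum H0 xz) lt_xN.
have gP y : move H x y -> exists z, y = g z.
  move=> xy; exists [ffun i => inord (y i)]; apply/ffunP=> i.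
  rewrite !ffunE inordK // ltnS.
  apply: leq_trans (_ : \sum_j y j <= N); first by rewrite (bigD1 i) ?leq_addr.
  exact: leq_trans (ltnW (move_sum H0 xy)) lt_xN.
exists (\max_(z | move H x (g z)) (h z).+1); split=> [|[|y s] //=].
  have [z0 xz0 | nox] := pickP (fun z => move H x (g z)); last first.
    by exists [::]; rewrite ?big_pred0.
  have [|z xz ->] := eq_bigmax_cond (A := [pred z | move H x (g z)]) (fun z => (h z).+1).
    by apply/card_gt0P; exists z0.
  have [[s zs <-] _] := hP z xz.
  by exists (g z :: s) => //=; rewrite zs andbT.
case/andP=> xy ys; have [z def_y] := gP y xy; rewrite {}def_y in xy ys.
apply: (bigmax_sup z) => //; rewrite ltnS.
by have [_] := hP z xy; apply.
Qed.

Lemma height_unique H x m n : is_height H x m -> is_height H x n -> m = n.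
Proof.
move=> [[s xs <-] max_m] [[t xt <-] max_n].
by apply/eqP; rewrite eqn_leq max_m // max_n.
Qed.

Lemma min_pos_le V x i : i \in V -> min_pos V x <= x i.
Proof.
rewrite /min_pos; move: (\max_(j in V) _) => d iV.
have := mem_index_enum i; elim: (index_enum T) => //= j s IHs.
rewrite big_cons inE => /predU1P[<-|/IHs le_i]; first by rewrite iV geq_minl.
by case: ifP => // _; apply: leq_trans le_i; apply: geq_minr.
Qed.

Lemma min_pos_attained V x : V != set0 ->
  exists2 i, i \in V & min_pos V x = x i.
Proof.
case/set0Pn=> i0 i0V; rewrite /min_pos.
apply: (big_ind (fun m => exists2 i, i \in V & m = x i)) => [|m n [i iV ->] [j jV ->]|i iV];
  last by exists i.
  have /(eq_bigmax_cond x)[i iV ->] : 0 < #|V| by apply/card_gt0P; exists i0.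
  by exists i.
by case: (leqP (x i) (x j)) => _; [exists i | exists j].
Qed.

End Hypergraph.

(* Main.v *)
(** A move of the compound is a simultaneous move in every component, so its
    height is the least height of a component; playing all the
    minimum-decreasing moves at once therefore lowers both the height and the
    minimum.  Transversality is decided componentwise.  Chains are obtained by
    replacing the components of an edge one at a time; the components that stay
    put (here [2 <= p] matters) make consecutive edges intersect, so that in a
    component only [#|H_(i+1) :\: H_i| = 1] and containment are needed.  All of
    this also applies to two disjoint singletons. *)

Require Import Defs.
From mathcomp Require Import all_boot.

Set Implicit Arguments.
Unset Strict Implicit.
Unset Printing Implicit Defensive.

Section Hypergraph.

Variable T : finType.
Implicit Types (V S U E F : {set T}) (H : {set {set T}}) (x y : {ffun T -> nat}).

Lemma edge_sub V H E : is_hypergraph V H -> E \in H -> E \subset V.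
Proof. by case=> _ _ <- EH; apply: bigcup_sup. Qed.

Lemma edge_neq0 V H E : is_hypergraph V H -> E \in H -> E != set0.
Proof. by case=> _ H0 _ EH; apply: contraNneq H0 => <-. Qed.

Lemma edge_exists V H : is_hypergraph V H -> exists E, E \in H.
Proof.
case=> V0 _ cV; have /set0Pn[t] := V0.
by rewrite -cV => /bigcupP[E EH _]; exists E.
Qed.

(** * Plays *)

(** Playability of a fixed [n] obeys a recursion on moves and distributes over components, with no
    maximum to carry along. *)
Definition playable H x n :=
  exists2 s : seq {ffun T -> nat}, path (move H) x s & size s = n.

Lemma playable0 H x : playable H x 0.
Proof. by exists [::]. Qed.

Lemma playableS H x n :
  playable H x n.+1 <-> exists2 y, move H x y & playable H y n.
Proof.
split=> [[[|y s] //= /andP[xy ys] [sz]] | [y xy [s ys sz]]].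
  by exists y => //; exists s.
by exists (y :: s) => /=; rewrite ?xy ?sz.
Qed.

Lemma playable_le H x m n : m <= n -> playable H x n -> playable H x m.
Proof.
move=> le_mn [s xs sz]; exists (take m s); first exact: take_path.
by rewrite size_takel ?sz.
Qed.

(** Prefixes of plays are plays, so the playable lengths form an initial segment whose top element
    is the height. *)
Lemma is_heightP H x n :
  (forall m, playable H x m <-> m <= n) <-> is_height H x n.
Proof.
split=> [hP | [xn max_n] m].
  by split=> [|s xs]; [apply/hP | apply/hP; exists s].
by split=> [[s xs <-] | le_mn]; [apply: max_n | apply: playable_le xn].
Qed.

(** * Singletons *)

Definition singletons V : {set {set T}} := [set [set c] | c in V].

Definition decr x c : {ffun T -> nat} := [ffun i => x i - (i == c)].

Lemma move_decr V x c : c \in V -> 0 < x c -> move (singletons V) x (decr x c).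
Proof.
move=> cV xc; apply/existsP; exists [set c]; rewrite imset_f //=.
apply/forallP=> i; rewrite ffunE inE.
by case: eqVneq => [->|_]; rewrite ?subn0 // subn1 prednK.
Qed.

Lemma sum_decr V x c : c \in V -> 0 < x c ->
  (\sum_(i in V) decr x c i).+1 = \sum_(i in V) x i.
Proof.
move=> cV xc; rewrite (bigD1 c) //= [RHS](bigD1 c) //= ffunE eqxx subn1.
rewrite -addSn prednK //; congr (_ + _); apply: eq_bigr => i /andP[_ /negPf ic].
by rewrite ffunE ic subn0.
Qed.

Lemma move_singletons_sum V x y : move (singletons V) x y ->
  \sum_(i in V) y i < \sum_(i in V) x i.
Proof.
case/existsP=> _ /andP[/imsetP[c cV ->] /forallP xy].
rewrite (bigD1 c) //= [X in _ < X](bigD1 c) //= -addSn leq_add //.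
  by have := xy c; rewrite set11.
by apply: leq_sum => i _; have := xy i; case: ifP => _ => [/ltnW|/eqP->].
Qed.

(** Every move lowers the sum over [V], and while the sum is positive some coordinate can be lowered
    by exactly one. *)
Lemma height_singletons V x : is_height (singletons V) x (\sum_(i in V) x i).
Proof.
apply/is_heightP => n; elim: n x => [|n IHn] x.
  by split=> // _; apply: playable0.
split=> [/playableS[y xy /IHn] | lt_n].
  by move=> le_n; apply: leq_ltn_trans le_n (move_singletons_sum xy).
have [/forall_inP x0 | ] := boolP [forall c in V, x c == 0].
  by move: lt_n; rewrite big1 // => c /x0/eqP.
rewrite negb_forall_in => /exists_inP[c cV]; rewrite -lt0n => xc.
apply/playableS; exists (decr x c); first exact: move_decr.
by apply/IHn; rewrite -ltnS sum_decr.
Qed.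

Lemma minimum_decreasing_singletons V :
  V != set0 -> minimum_decreasing V (singletons V).
Proof.
(* The move lowers by one a coordinate [c] at which the minimum is attained. *)
move=> V0 x _ x_gt0; have [c cV mc] := min_pos_attained x V0.
have xc : 0 < x c by rewrite -mc.
exists (decr x c); split; first exact: move_decr.
- apply: leq_ltn_trans (min_pos_le _ cV) _.
  by rewrite ffunE eqxx mc subn1 prednK.
- exists (\sum_(i in V) decr x c i); last exact: height_singletons.
  by rewrite (sum_decr cV xc); apply: height_singletons.
move=> i _; rewrite ffunE; case: eqP => _; rewrite ?subn0 ?subnn //.
by rewrite leq_subLR addn1 subn1 leqSpred.
Qed.

Lemma singletons2 a b : singletons [set a; b] = [set [set a]; [set b]].
Proof. by rewrite /singletons imsetU !imset_set1. Qed.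

(** The two edges are disjoint, so neither is transversal. A proper subset omits a vertex [d], so it
    contains at most one edge, and that edge meets itself. *)
Lemma minimal_transversal_free_singletons2 a b : a != b ->
  minimal_transversal_free [set a; b] (singletons [set a; b]).
Proof.
move=> ab; split=> [[_ [/imsetP[c cV ->] tr]] | S /properP[_ [d dV dS]]].
  have [d dV dc] : exists2 d, d \in [set a; b] & d != c.
    by move: cV; rewrite !inE => /orP[]/eqP->;
      [exists b | exists a]; rewrite ?inE ?eqxx ?orbT // eq_sym.
  case/set0Pn: (tr [set d] (imset_f _ dV)) => e; rewrite !inE => /andP[/eqP->].
  by rewrite eq_sym (negPf dc).
case/set0Pn=> E EH; exists E; split=> // F.
have only e e' : e \in [set a; b] -> e' \in [set a; b] -> e != d -> e' != d -> e = e'.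
  by move: dV; rewrite !inE => /orP[]/eqP-> /orP[]/eqP-> /orP[]/eqP->; rewrite ?eqxx.
move: EH; rewrite !inE => /andP[/imsetP[e eV ->] eS] /andP[/imsetP[e' eV' ->] eS'].
rewrite (only e e') // ?setIid; first by apply/set0Pn; exists e'; rewrite set11.
  by apply: contraNneq dS => <-; rewrite -sub1set.
by apply: contraNneq dS => <-; rewrite -sub1set.
Qed.

(** * Chains as paths of a relation *)

(** Containment in the union of the two ends becomes a condition on single steps relative to a fixed
    [U]; chains can then be concatenated by transitivity of [connect]. *)
Definition bounded_step H U E F := [&& F \in H, F \subset U & chain_step E F].

(** Consecutive edges may be disjoint here, which admits the step from one singleton to another. *)
Definition weak_bounded_step H U E F := [&& F \in H, F \subset U & #|F :\: E| == 1].

Definition weak_chain_property H := forall E F, E \in H -> F \in H ->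
  connect (weak_bounded_step H (E :|: F)) E F.

Lemma chain_weak H : chain_property H -> weak_chain_property H.
Proof.
move=> ch E F EH FH; have [->|EF] := eqVneq E F; first exact: connect0.
have [s /and3P[/= /andP[_ sH] ps /andP[_ sU]] lF] := ch E F EH FH EF.
rewrite lF in sU; apply/connectP; exists s => //.
(* The bound is frozen as [U] before the induction, in which the first edge varies. *)
move: (E :|: F) sU => U sU; elim: s E sH ps sU {EH EF lF} => //= G s IHs E /andP[GH sH] /andP[/andP[_ EG] ps] /andP[GU sU].
by rewrite IHs // andbT; apply/and3P.
Qed.

Lemma connect_chain H E F : E \in H ->
  connect (bounded_step H (E :|: F)) E F -> exists2 s, chain H E s & last E s = F.
Proof.
move=> EH /connectP[s ps lF]; exists s => //.
rewrite /chain /= EH -lF subsetUl /=.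
move: (E :|: F) ps => U ps; elim: s E ps {EH lF} => //= G s IHs E.
by case/andP=> /and3P[-> -> ->] /IHs/and3P[-> -> ->].
Qed.

Lemma weak_chain_singletons V : weak_chain_property (singletons V).
Proof.
move=> _ F /imsetP[c cV ->] /imsetP[d dV ->].
have [->|dc] := eqVneq d c; first exact: connect0.
apply: connect1; apply/and3P; split; rewrite ?imset_f ?subsetUr //.
apply/cards1P; exists d; apply/setP=> e; rewrite !inE.
by have [->|_] := eqVneq e d; rewrite ?andbF ?andbT.
Qed.

End Hypergraph.

Section Compound.

Variables (T : finType) (p : nat) (V : 'I_p -> {set T}) (H : 'I_p -> {set {set T}}).
Hypothesis disjV : forall i j : 'I_p, i != j -> [disjoint V i & V j].
Hypothesis hypH : forall i, is_hypergraph (V i) (H i).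
Implicit Types (f g U : 'I_p -> {set T}) (x y : {ffun T -> nat}).

Let C := conj_compound H.

(** * Edges of the compound and their components *)

Lemma compoundP E :
  reflect (exists2 f, (forall i, f i \in H i) & E = \bigcup_i f i) (E \in C).
Proof.
apply: (iffP imsetP) => [[f /familyP fH ->] | [f fH ->]]; first by exists f.
exists (finfun f); first by apply/familyP=> i; rewrite ffunE.
by apply: eq_bigr => i _; rewrite ffunE.
Qed.

Lemma mem_compound f : (forall i, f i \in H i) -> \bigcup_i f i \in C.
Proof. by move=> fH; apply/compoundP; exists f. Qed.

(** By disjointness only the component [f i] has vertices in [V i], so a union determines its
    components. *)
Lemma mem_bigcup_part f i t :
  (forall j, f j \subset V j) -> t \in V i -> (t \in \bigcup_j f j) = (t \in f i).
Proof.
move=> fV tV; apply/bigcupP/idP => [[j _ tj] | ti]; last by exists i.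
have [<- //|ji] := eqVneq j i.
by case/negP: (disjointFr (disjV ji) (subsetP (fV j) t tj)).
Qed.

Lemma edges_exist : exists f, forall i, f i \in H i.
Proof.
have /fin_all_exists[f fH] i : exists E, E \in H i by apply: edge_exists (hypH i).
by exists f.
Qed.

Lemma compound_hypergraph : 0 < p -> is_hypergraph (\bigcup_i V i) C.
Proof.
move=> p0; pose i0 := Ordinal p0; split.
- have [/set0Pn[t tV] _ _] := hypH i0.
  by apply/set0Pn; exists t; apply/bigcupP; exists i0.
- apply/negP => /compoundP[f fH /esym/eqP].
  have /set0Pn[t ti] := edge_neq0 (hypH i0) (fH i0).
  by move/eqP/setP/(_ t); rewrite inE => /bigcupP[]; exists i0.
apply/setP=> t; apply/bigcupP/bigcupP => [[E /compoundP[f fH ->]] | [i _ tV]].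
  by case/bigcupP=> i _ ti; exists i => //; apply: (subsetP (edge_sub (hypH i) (fH i))).
have [_ _ cV] := hypH i; move: tV; rewrite -cV => /bigcupP[E EH tE].
(* The edge [E] through [t] is completed by arbitrary edges in the other components. *)
have [f fH] := edges_exist; pose g j := if j == i then E else f j.
exists (\bigcup_j g j); last by apply/bigcupP; exists i; rewrite // /g eqxx.
by apply: mem_compound => j; rewrite /g; case: eqP => // ->.
Qed.

(** * Transversals *)

(** Each component [f i] misses some edge [g i]; since the vertex sets are disjoint, the union of
    the [g i] misses the union of the [f i]. *)
Lemma compound_transversal_free :
  (forall i, transversal_free (H i)) -> transversal_free C.
Proof.
move=> tf [_ [/compoundP[f fH ->] tr]].
have /fin_all_exists2[g gH fg] i : exists2 F, F \in H i & f i :&: F = set0.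
  have [/exists_inP[F FH /eqP fF] | ] := boolP [exists F in H i, f i :&: F == set0].
    by exists F.
  rewrite negb_exists_in => /forall_inP no.
  by case: (tf i); exists (f i).
case/set0Pn: (tr _ (mem_compound gH)) => t /setIP[/bigcupP[i _ ti]].
have fV j := edge_sub (hypH j) (fH j); have gV j := edge_sub (hypH j) (gH j).
rewrite (mem_bigcup_part gV (subsetP (fV i) t ti)) => tg.
by have /setP/(_ t) := fg i; rewrite !inE ti tg.
Qed.

(** A proper subset [S] omits a vertex of some [V i], so [S :&: V i] is proper and its induced
    family has a transversal edge. Put in place of the [i]-th component of any edge inside [S], it
    makes that edge transversal: meeting in component [i] is enough. *)
Lemma compound_minimal_transversal_free :
  (forall i, minimal_transversal_free (V i) (H i)) ->
  minimal_transversal_free (\bigcup_i V i) C.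
Proof.
move=> mtf; split; first by apply: compound_transversal_free => i; case: (mtf i).
move=> S /properP[SV [t /bigcupP[i _ tVi] tS]] /set0Pn[_ /setIdP[/compoundP[f fH ->] fS]].
have fiS j : f j \subset S by apply: subset_trans fS; apply: bigcup_sup.
have prop : S :&: V i \proper V i.
  by apply/properP; split; rewrite ?subsetIr //; exists t; rewrite // inE (negPf tS).
have inducedE F : (F \in induced (H i) (S :&: V i)) = (F \in H i) && (F \subset S).
  rewrite inE subsetI; case: (boolP (F \in H i)) => //= FH.
  by rewrite (edge_sub (hypH i) FH) andbT.
have [|E [EI tr]] := (mtf i).2 _ prop.
  by apply/set0Pn; exists (f i); rewrite inducedE fH fiS.
move: EI; rewrite inducedE => /andP[EH ES].
pose g j := if j == i then E else f j.
have gi : g i = E by rewrite /g eqxx.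
exists (\bigcup_j g j); split=> [|_ /setIdP[/compoundP[k kH ->] kS]].
  rewrite inE mem_compound => [|j]; last by rewrite /g; case: eqP => // ->.
  by apply/bigcupsP=> j _; rewrite /g; case: eqP.
have /tr : k i \in induced (H i) (S :&: V i).
  by rewrite inducedE kH (subset_trans _ kS) // bigcup_sup.
rewrite -gi => /set0Pn[s /setIP[sg sk]].
by apply/set0Pn; exists s; apply/setIP; split; apply/bigcupP; exists i.
Qed.

(** * Heights *)

(** Extension by zero makes this a position on [V i]. *)
Definition part i x : {ffun T -> nat} := [ffun t => if t \in V i then x t else 0].

Lemma part_in i x t : t \in V i -> part i x t = x t.
Proof. by rewrite ffunE => ->. Qed.

Lemma move_part i x y : move C x y -> move (H i) (part i x) (part i y).
Proof.
case/existsP=> _ /andP[/compoundP[f fH ->] /forallP xy].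
have fV j := edge_sub (hypH j) (fH j).
apply/existsP; exists (f i); rewrite fH; apply/forallP=> t; have := xy t.
rewrite !ffunE; have [tV | tV _] := boolP (t \in V i).
  by rewrite (mem_bigcup_part fV tV).
by case: ifP => // ti; rewrite (subsetP (fV i) t ti) in tV.
Qed.

Lemma move_glue x (z : 'I_p -> {ffun T -> nat}) :
  (forall i, move (H i) (part i x) (z i)) ->
  exists2 y, move C x y & forall i, part i y = z i.
Proof.
move=> mz.
have /fin_all_exists2[f fH fz] i : exists2 E, E \in H i &
    forall t, if t \in E then z i t < part i x t else z i t == part i x t.
  by have /existsP[E /andP[EH /forallP Ez]] := mz i; exists E.
have fV i := edge_sub (hypH i) (fH i).
(* At most one [i] can be picked. A vertex outside every [V i] lies in no edge, so it must keep its
   value. *)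
pose y := [ffun t => if [pick i | t \in V i] is Some i then z i t else x t].
have yE i t : t \in V i -> y t = z i t.
  rewrite ffunE => tV; case: pickP => [j tj | /(_ i)]; last by rewrite tV.
  by have [-> //|ji] := eqVneq j i; rewrite (disjointFr (disjV ji) tj) in tV.
exists y => [|i]; last first.
  apply/ffunP=> t; rewrite ffunE; case: ifP => tV; first exact: yE.
  have := fz i t; rewrite ffunE tV; case: ifP => [ti|_ /eqP-> //].
  by rewrite (subsetP (fV i) t ti) in tV.
apply/existsP; exists (\bigcup_i f i); rewrite mem_compound //=.
apply/forallP=> t; have [i tV | noV] := pickP (fun i => t \in V i).
  by rewrite (mem_bigcup_part fV tV) (yE i) // -(part_in x tV).
rewrite ifF; first by rewrite ffunE; case: pickP => // i; rewrite noV.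
by apply/bigcupP=> [[i _ /(subsetP (fV i))]]; rewrite noV.
Qed.

Lemma playable_compound x n :
  playable C x n <-> forall i, playable (H i) (part i x) n.
Proof.
elim: n x => [|n IHn] x; first by split=> *; apply: playable0.
split=> [/playableS[y xy /IHn yn] i | xn].
  by apply/playableS; exists (part i y) => //; apply: move_part.
have /fin_all_exists2[z xz zn] i :
    exists2 y, move (H i) (part i x) y & playable (H i) y n by apply/playableS.
have [y xy yz] := move_glue xz.
by apply/playableS; exists y => //; apply/IHn => i; rewrite yz.
Qed.

Lemma height_compound x (h : 'I_p -> nat) k :
  (forall i, is_height (H i) (part i x) (h i)) -> (forall i, h k <= h i) ->
  is_height C x (h k).
Proof.
move=> hP hk; apply/is_heightP => n; split=> [/playable_compound xn | le_n].
  by have /is_heightP/(_ n)[le_n _] := hP k; apply: le_n.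
apply/playable_compound => i; have /is_heightP/(_ n)[_] := hP i; apply.
exact: leq_trans (hk i).
Qed.

Lemma compound_minimum_decreasing :
  0 < p -> (forall i, minimum_decreasing (V i) (H i)) ->
  minimum_decreasing (\bigcup_i V i) C.
Proof.
move=> p0 md x _ x_gt0.
have V0 i : V i != set0 by case: (hypH i).
have Vsub i t : t \in V i -> t \in \bigcup_j V j by move=> tV; apply/bigcupP; exists i.
have /fin_all_exists[z zP] i : exists z,
    [/\ move (H i) (part i x) z, min_pos (V i) z < min_pos (V i) (part i x),
     exists2 n, is_height (H i) (part i x) n.+1 & is_height (H i) z n
     & forall t, t \in V i -> part i x t - z t <= 1].
  apply: md => [t /negPf tV|]; first by rewrite ffunE tV.
  have [t tV ->] := min_pos_attained (part i x) (V0 i).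
  by rewrite part_in //; apply: leq_trans x_gt0 _; apply/min_pos_le/Vsub/tV.
have /fin_all_exists2[h hx hz] i :
    exists2 n, is_height (H i) (part i x) n.+1 & is_height (H i) (z i) n.
  by case: (zP i).
have [y xy yz] : exists2 y, move C x y & forall i, part i y = z i.
  by apply: move_glue => i; case: (zP i).
have yE i t : t \in V i -> y t = z i t by move=> tV; rewrite -yz part_in.
exists y; split=> //.
(* If the minimum of [x] is attained in [V i], then the move in component [i] alone already brings
   the minimum below it. *)
- have [|t /bigcupP[i _ tV] ->] := @min_pos_attained _ (\bigcup_i V i) x.
    by have [] := compound_hypergraph p0.
  have [s sV zs] := min_pos_attained (z i) (V0 i).
  have [_ lt_z _ _] := zP i.
  apply: leq_ltn_trans (min_pos_le y (Vsub i s sV)) _.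
  by rewrite (yE i) // -zs -(part_in x tV) (leq_trans lt_z) // min_pos_le.
(* The component heights are [(h i).+1] before and [h i] after the move, so one index attains both
   minima. *)
- pose k := [arg min_(i < Ordinal p0) h i].
  have hk i : h k <= h i by rewrite /k; case: arg_minnP => // j _; apply.
  exists (h k); first exact: (height_compound (h := fun i => (h i).+1)).
  by apply: height_compound => // i; rewrite yz.
move=> t /bigcupP[i _ tV]; rewrite (yE i) // -(part_in x tV).
by have [_ _ _] := zP i; apply.
Qed.

(** * Chains *)

Definition replace f i E j := if j == i then E else f j.

Lemma connect_replace U f i E : 1 < p ->
  (forall j, f j \in H j) -> (forall j, f j \subset U j) ->
  connect (weak_bounded_step (H i) (U i)) (f i) E ->
  connect (bounded_step C (\bigcup_j U j)) (\bigcup_j f j) (\bigcup_j replace f i E j).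
Proof.
move=> p1 fH fU /connectP[s ps ->] {E}.
elim: s f fH fU ps => [|E s IHs] f fH fU /=.
  move=> _; apply: eq_connect0; apply: eq_bigr => j _.
  by rewrite /replace; case: eqP => // ->.
case/andP=> /and3P[EH EU step] ps; pose g := replace f i E.
have gi : g i = E by rewrite /g /replace eqxx.
have gH j : g j \in H j by rewrite /g /replace; case: eqP => // ->.
have gU j : g j \subset U j by rewrite /g /replace; case: eqP => // ->.
(* The rest of the path starts from [g]; replacing component [i] again overwrites the first
   replacement. *)
apply: (@connect_trans _ _ (\bigcup_j g j)); last first.
  have := IHs g gH gU; rewrite gi => /(_ ps).
  congr connect; apply: eq_bigr => j _.
  by rewrite /g /replace; case: eqP.
have fV j := edge_sub (hypH j) (fH j); have gV j := edge_sub (hypH j) (gH j).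
apply: connect1; apply/and3P; split; first exact: mem_compound.
  by apply/bigcupsP=> j _; apply: subset_trans (gU j) (bigcup_sup _ _).
apply/andP; split.
  (* An unchanged nonempty component [j] makes the two unions intersect. *)
  have [j ji] : exists j, j != i.
    have /card_gt0P[j ji] : 0 < #|predC1 i|.
      by rewrite cardC1 card_ord -subn1 subn_gt0.
    by exists j.
  have /set0Pn[t tf] := edge_neq0 (hypH j) (fH j).
  apply/set0Pn; exists t; apply/setIP; split; apply/bigcupP; exists j => //.
  by rewrite /g /replace (negPf ji).
(* The unions agree outside [V i], so their difference is that of the [i]-th components. *)
rewrite -(eqP step) -gi; apply/eqP; congr #|pred_of_set _|; apply/setP=> t.
rewrite !in_setD; have [tV | tV] := boolP (t \in V i).
  by rewrite (mem_bigcup_part fV tV) (mem_bigcup_part gV tV).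
have -> : (t \in g i) = false by apply: contraNF tV; apply: (subsetP (gV i)).
rewrite andbF; apply/andP=> [[/negP tf /bigcupP[j _ tg]]]; apply: tf.
apply/bigcupP; exists j => //; move: tg; rewrite /g /replace.
case: eqP => // ji tE; case/negP: tV.
by rewrite -ji (subsetP (gV j)) // /g /replace ji eqxx.
Qed.

Lemma compound_chain_property :
  1 < p -> (forall i, weak_chain_property (H i)) -> chain_property C.
Proof.
move=> p1 wc _ _ /compoundP[f fH ->] /compoundP[g gH ->] _.
apply: connect_chain; first exact: mem_compound.
rewrite -big_split /=; set U := fun i => f i :|: g i.
(* The components listed in [r] have already been switched from [f] to [g]; with [r] the full
   enumeration the chain is complete. *)
pose mix (r : seq 'I_p) j := if j \in r then g j else f j.
have mixP r : connect (bounded_step C (\bigcup_i U i))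
    (\bigcup_i f i) (\bigcup_i mix r i).
  elim: r => [|i r IHr]; first exact: connect0.
  apply: connect_trans IHr _.
  have -> : \bigcup_j mix (i :: r) j = \bigcup_j replace (mix r) i (g i) j.
    apply: eq_bigr => j _; rewrite /mix /replace inE.
    by case: eqP => [->|].
  apply: connect_replace => // [j|j|].
  - by rewrite /mix; case: ifP.
  - by rewrite /mix; case: ifP => _; rewrite ?subsetUl ?subsetUr.
  (* If [i] already occurs in [r], nothing changes; otherwise a weak chain from [f i] to [g i]
     inside [U i] is used. *)
  by rewrite /mix; case: ifP => _; [apply: connect0 | apply: wc].
have := mixP (enum 'I_p); congr connect; apply: eq_bigr => i _.
by rewrite /mix mem_enum.
Qed.

End Compound.

Theorem theorem1 (T : finType) (p : nat) (V : 'I_p -> {set T})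
    (H : 'I_p -> {set {set T}}) :
  2 <= p ->
  (forall i j : 'I_p, i != j -> [disjoint V i & V j]) ->
  (forall i : 'I_p, is_hypergraph (V i) (H i)) ->
  (forall i : 'I_p, JM_plus (V i) (H i) \/ two_singletons (V i) (H i)) ->
  is_hypergraph (\bigcup_i V i) (conj_compound H) /\
  JM_plus (\bigcup_i V i) (conj_compound H).
Proof.
move=> p2 disjV hypH JM; have p0 := ltnW p2.
(* Both kinds of component share these three properties; the chain property is weakened because two
   disjoint singletons violate it. *)
have {}JM i : [/\ minimal_transversal_free (V i) (H i),
    minimum_decreasing (V i) (H i) & weak_chain_property (H i)].
  case: (JM i) => [[mtf md /chain_weak] //|[a [b [ab -> ->]]]].
  rewrite -singletons2; split; first exact: minimal_transversal_free_singletons2.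
    apply: minimum_decreasing_singletons.
    by apply/set0Pn; exists a; rewrite !inE eqxx.
  exact: weak_chain_singletons.
split; first exact: compound_hypergraph.
split.
- by apply: (compound_minimal_transversal_free disjV hypH) => i; case: (JM i).
- by apply: (compound_minimum_decreasing disjV hypH) => // i; case: (JM i).
by apply: (compound_chain_property disjV hypH) => // i; case: (JM i).
Qed.
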